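(* Let $m$ be a positive integer and $q=2^m$. Then $$f(x)=x^2+x^{3q^2-q+1}+x^{3q^3-q^2+q}+x^{q^2-q+3}+x^{q^3-q^2+3q}$$ is a permutation polynomial over $\mathbb{F}_{q^3}$.
   Context: $\mathbb{F}_{q^3}$ denotes the finite field with $q^3$ elements. A polynomial $f\in\mathbb{F}_{q^3}[x]$ is a permutation polynomial over $\mathbb{F}_{q^3}$ if the associated map $c\mapsto f(c)$ from $\mathbb{F}_{q^3}$ to itself is a bijection. *)

(* Defs.v *)
From HB Require Import structures.
From mathcomp Require Import all_boot all_order all_algebra all_field.

Set Implicit Arguments.
Unset Strict Implicit.
Unset Printing Implicit Defensive.

Import GRing.Theory.
Local Open Scope ring_scope.

Definition permutation_polynomial (F : finFieldType) (f : {poly F}) : Prop :=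
  bijective (fun c : F => f.[c]).

(* Main.v *)
(** Let [T], [E], [N] be the elementary symmetric functions of the conjugates of
    a nonzero [x], and let [s] be the square root of [N].  In characteristic 2
    one finds [f x = a ^+ 2] with [a = x (T x + T ^+ 2 + s) / s], so it is enough
    to recover [x] from [a].  The trace of [a] is again [T].  Putting [e = E / s],
    the other two symmetric functions [E'], [N'] of [a] satisfy
    [(T ^+ 2 e + s) ^+ 2 = N' + T ^+ 2 E' + T ^+ 4 + T ^+ 5], so
    [w = T ^+ 2 e + s] is determined by [a], and [E'] is affine in [e] with slope
    [T ^+ 2 + w + T ^+ 3].
    - If the slope is nonzero, then [e] and [s] are determined; two solutions [x]
      of the resulting quadratic equation differ by an element fixed by
      conjugation and of trace zero, hence by [0].
    - If the slope vanishes, then [E' = T ^+ 4] and [N' = T ^+ 5], so [a] is a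
      root of [(X - T) (X - T ^+ 2) ^+ 2] and lies in the subfield with [q]
      elements; then so does [x], and [x = T]. *)

Require Import Defs.
From HB Require Import structures.
From mathcomp Require Import all_boot all_order all_algebra all_field.
From mathcomp Require Import ring.

Set Implicit Arguments.
Unset Strict Implicit.
Unset Printing Implicit Defensive.

Import GRing.Theory.
Local Open Scope ring_scope.

(** * Symmetric functions of the conjugates *)

Definition conj_trace (F : fieldType) (phi : F -> F) (x : F) : F :=
  x + phi x + phi (phi x).

Definition conj_e2 (F : fieldType) (phi : F -> F) (x : F) : F :=
  x * phi x + x * phi (phi x) + phi x * phi (phi x).

Definition conj_norm (F : fieldType) (phi : F -> F) (x : F) : F :=
  x * phi x * phi (phi x).

(* The square root of the polynomial map when [s ^+ 2 = conj_norm phi x]. *)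
Definition twist (F : fieldType) (phi : F -> F) (x s : F) : F :=
  let T := conj_trace phi x in x * (T * x + T ^+ 2 + s) / s.

Lemma sqr_inj_char2 (F : fieldType) (ch2 : 2%:R = 0 :> F) :
  injective (fun x : F => x ^+ 2).
Proof.
move=> x y /= exy; apply/eqP; rewrite -subr_eq0 -sqrf_eq0; apply/eqP.
have -> : (x - y) ^+ 2 = x ^+ 2 - y ^+ 2 + 2%:R * (y ^+ 2 - x * y) by ring.
by rewrite exy ch2 mul0r subrr addr0.
Qed.

Lemma conj_root (F : fieldType) (phi : F -> F) (x : F) :
  x ^+ 3 - conj_trace phi x * x ^+ 2 + conj_e2 phi x * x - conj_norm phi x = 0.
Proof. rewrite /conj_trace /conj_e2 /conj_norm; ring. Qed.

Lemma conj_trace_fixed (F : fieldType) (ch2 : 2%:R = 0 :> F) (phi : F -> F)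
    (x : F) : phi x = x -> conj_trace phi x = x.
Proof.
move=> px; rewrite /conj_trace !px.
have -> : x + x + x = x + 2%:R * x by ring.
by rewrite ch2 mul0r addr0.
Qed.

Lemma phi_conj_trace (F : fieldType) (phi : {rmorphism F -> F})
    (phi3 : forall x, phi (phi (phi x)) = x) (x : F) :
  phi (conj_trace phi x) = conj_trace phi x.
Proof. rewrite /conj_trace !rmorphD /= phi3; ring. Qed.

(** [phi] fixes [s ^+ 2], and square roots are unique in characteristic 2. *)
Lemma phi_sqrt_norm (F : fieldType) (ch2 : 2%:R = 0 :> F)
    (phi : {rmorphism F -> F}) (phi3 : forall x, phi (phi (phi x)) = x)
    (x s : F) : s ^+ 2 = conj_norm phi x -> phi s = s.
Proof.
move=> es; apply: (sqr_inj_char2 ch2) => /=.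
rewrite -rmorphXn /= es /conj_norm !rmorphM /= phi3; ring.
Qed.

(* [ring] and [field] do not know that [2 = 0], here and below the terms that
   vanish in characteristic 2 are therefore written out with a factor [2%:R]. *)
Lemma twist_invariants (F : fieldType) (ch2 : 2%:R = 0 :> F)
    (phi : {rmorphism F -> F}) (phi3 : forall x, phi (phi (phi x)) = x)
    (x s : F) (s0 : s != 0) (es : s ^+ 2 = conj_norm phi x) :
  let T := conj_trace phi x in let e := conj_e2 phi x / s in
  let a := twist phi x s in
  [/\ conj_trace phi a = T,
      conj_e2 phi a = T ^+ 2 * e ^+ 2 + (T ^+ 2 + s) * e + T * (T ^+ 2 + s)
    & conj_norm phi a =
      T ^+ 3 * s + T ^+ 2 * (T ^+ 2 + s) * e + T ^+ 4 + s ^+ 2].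
Proof.
move=> T e a.
have pT : phi T = T := phi_conj_trace phi3 x.
have ps : phi s = s := phi_sqrt_norm ch2 phi3 es.
have pb t u : phi t = t ->
    phi (u * (t * u + t ^+ 2 + s) / s) = phi u * (t * phi u + t ^+ 2 + s) / s.
  by move=> pt; rewrite !(rmorphM, rmorphD, fmorphV, rmorphXn) /= pt ps.
have pa : phi a = phi x * (T * phi x + T ^+ 2 + s) / s by exact: pb.
have ppa : phi (phi a) = phi (phi x) * (T * phi (phi x) + T ^+ 2 + s) / s.
  by rewrite pa; exact: pb.
have ea : a = x * (T * x + T ^+ 2 + s) / s by [].
rewrite /conj_trace /conj_e2 /conj_norm ppa pa ea.
have eT : T = conj_trace phi x by [].
have {e a pa ppa ea pT ps pb} -> : e = conj_e2 phi x / s by [].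
move: es eT; rewrite /conj_norm /conj_trace /conj_e2.
(* The conjugates become variables [x], [y], [z] tied by [s ^+ 2 = x * y * z]; clearing powers of
   [s] leaves polynomial identities modulo 2. *)
move: (phi x) (phi (phi x)) => y z es; move: T => T eT.
set E := x * y + x * z + y * z.
split.
- apply: (mulIf s0).
  rewrite -[RHS]addr0 -(mul0r (T ^+ 3 - E * T)) -ch2.
  by rewrite /E eT; field.
- apply: (mulIf (expf_neq0 2 s0)).
  rewrite -[RHS]addr0 -(mul0r (T ^+ 2 * (T ^+ 2 + s) * E
    - T ^+ 3 * (x * y * z) - 2%:R * T * (T ^+ 2 + s) * (x * y * z))) -ch2.
  transitivity (T ^+ 2 * E ^+ 2 + s * (T ^+ 2 + s) * E
    + T * (T ^+ 2 + s) * (x * y * z) + 2%:R * (T ^+ 2 * (T ^+ 2 + s) * E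
    - T ^+ 3 * (x * y * z) - 2%:R * T * (T ^+ 2 + s) * (x * y * z))).
    by rewrite /E eT; field.
  by rewrite -es; field.
- apply: (mulIf (expf_neq0 3 s0)).
  rewrite -[RHS]addr0 -(mul0r (x * y * z * ((T ^+ 2 + s) ^+ 2 * T ^+ 2
    + T ^+ 2 * s ^+ 2))) -ch2.
  transitivity (x * y * z * (T ^+ 3 * (x * y * z) + T ^+ 2 * (T ^+ 2 + s) * E
    + s * T ^+ 4 + s ^+ 3) + 2%:R * (x * y * z * ((T ^+ 2 + s) ^+ 2 * T ^+ 2
    + T ^+ 2 * s ^+ 2))).
    by rewrite /E eT; field.
  by rewrite -es; field.
Qed.

(** * Injectivity of the twist *)

(** A fixed element is its own trace, so the twist equals [T] and [(x - T) * (T * x + s) = 0]. If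
    the second factor vanishes, [x] is [- s / T], fixed by [phi] and so again its own trace. *)
Lemma twist_fixed (F : fieldType) (ch2 : 2%:R = 0 :> F)
    (phi : {rmorphism F -> F}) (phi3 : forall x, phi (phi (phi x)) = x)
    (x s : F) (s0 : s != 0) (es : s ^+ 2 = conj_norm phi x) :
  phi (twist phi x s) = twist phi x s -> x = conj_trace phi x.
Proof.
move=> pa; have [tra _ _] := twist_invariants ch2 phi3 s0 es.
have aT : twist phi x s = conj_trace phi x.
  by rewrite -[LHS](conj_trace_fixed ch2 pa).
have pT := phi_conj_trace phi3 x.
have ps := phi_sqrt_norm ch2 phi3 es.
move: aT; rewrite /twist; move eT: (conj_trace phi x) => T in pT * => aT.
have eTs : x * (T * x + T ^+ 2 + s) = T * s.
  by rewrite -[in RHS]aT divfK.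
have : (x - T) * (T * x + s) = 0.
  transitivity (x * (T * x + T ^+ 2 + s) - T * s - 2%:R * (T ^+ 2 * x)).
    by ring.
  by rewrite eTs ch2 mul0r !subrr.
move/eqP; rewrite mulf_eq0 subr_eq0 => /orP[/eqP //|/eqP Txs].
have T0 : T != 0.
  by apply: contraNneq s0 => T0; rewrite -Txs T0 mul0r add0r.
have ex : x = - s / T.
  by apply: (mulIf T0); rewrite divfK // mulrC; apply/eqP; rewrite -addr_eq0 Txs.
rewrite -eT conj_trace_fixed // ex !(rmorphM, rmorphN, fmorphV) /=.
by rewrite pT ps.
Qed.

(** Both pairs share [w], so the slope times [e - e'] is zero: the left alternative comes from
    [e = e'], the right one from a zero slope. *)
Lemma twist_parameter (F : fieldType) (ch2 : 2%:R = 0 :> F)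
    (T e s e' s' E N : F) :
    E = T ^+ 2 * e ^+ 2 + (T ^+ 2 + s) * e + T * (T ^+ 2 + s) ->
    E = T ^+ 2 * e' ^+ 2 + (T ^+ 2 + s') * e' + T * (T ^+ 2 + s') ->
    N = T ^+ 3 * s + T ^+ 2 * (T ^+ 2 + s) * e + T ^+ 4 + s ^+ 2 ->
    N = T ^+ 3 * s' + T ^+ 2 * (T ^+ 2 + s') * e' + T ^+ 4 + s' ^+ 2 ->
  s = s' \/ E = T ^+ 4 /\ N = T ^+ 5.
Proof.
have w2 e1 s1 : E = T ^+ 2 * e1 ^+ 2 + (T ^+ 2 + s1) * e1 + T * (T ^+ 2 + s1) ->
    N = T ^+ 3 * s1 + T ^+ 2 * (T ^+ 2 + s1) * e1 + T ^+ 4 + s1 ^+ 2 ->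
    (T ^+ 2 * e1 + s1) ^+ 2 = N + T ^+ 2 * E + T ^+ 4 + T ^+ 5.
  move=> -> ->; apply/eqP; rewrite -subr_eq0; apply/eqP.
  transitivity (- 2%:R * (T ^+ 3 * s1 + T ^+ 4 * e1 + T ^+ 4 + T ^+ 5));
    first by ring.
  by rewrite ch2 oppr0 mul0r.
move=> eE eE' eN eN'.
pose w := T ^+ 2 * e + s.
have ew : w = T ^+ 2 * e' + s'.
  by apply: (sqr_inj_char2 ch2); rewrite /= (w2 _ _ eE eN) (w2 _ _ eE' eN').
have Ew : E = (T ^+ 2 + w - T ^+ 3) * e + T ^+ 3 + T * w.
  by rewrite eE /w; ring.
have Ew' : E = (T ^+ 2 + w - T ^+ 3) * e' + T ^+ 3 + T * w.
  by rewrite eE' ew; ring.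
have : (T ^+ 2 + w - T ^+ 3) * (e - e') = 0.
  transitivity (E - E); last by rewrite subrr.
  by rewrite {1}Ew Ew'; ring.
move/eqP; rewrite mulf_eq0 => /orP[/eqP w0|].
  have wE : w = T ^+ 3 - T ^+ 2 by rewrite -[LHS](subr0) -w0; ring.
  have E4 : E = T ^+ 4 by rewrite Ew w0 mul0r wE; ring.
  right; split=> //.
  have := w2 _ _ eE eN; rewrite -/w wE E4 => NE.
  have -> : N = (T ^+ 3 - T ^+ 2) ^+ 2 - T ^+ 2 * T ^+ 4 - T ^+ 4 - T ^+ 5.
    by rewrite NE; ring.
  transitivity (T ^+ 5 - 2%:R * (2%:R * T ^+ 5)); first by ring.
  by rewrite ch2 mul0r subr0.
rewrite subr_eq0 => /eqP ee'; left.
by apply: (addrI (T ^+ 2 * e)); rewrite -/w ew ee'.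
Qed.

Lemma twist_inj_same_norm (F : fieldType) (ch2 : 2%:R = 0 :> F)
    (phi : {rmorphism F -> F}) (phi3 : forall x, phi (phi (phi x)) = x)
    (x x' s : F) (s0 : s != 0) (es : s ^+ 2 = conj_norm phi x) :
  conj_trace phi x = conj_trace phi x' -> twist phi x s = twist phi x' s ->
  x = x'.
Proof.
move=> eT; have pT := phi_conj_trace phi3 x.
have ps := phi_sqrt_norm ch2 phi3 es.
have tr0 : conj_trace phi (x - x') = 0.
  transitivity (conj_trace phi x - conj_trace phi x').
    by rewrite /conj_trace !rmorphB /=; ring.
  by rewrite eT subrr.
move/(mulIf (invr_neq0 s0)); rewrite -eT.
move: pT; move: (conj_trace phi x) => T pT eb.
have : (x - x') * (T * (x + x') + T ^+ 2 + s) = 0.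
  transitivity (x * (T * x + T ^+ 2 + s) - x' * (T * x' + T ^+ 2 + s)).
    by ring.
  by rewrite eb subrr.
move/eqP; rewrite mulf_eq0 subr_eq0 => /orP[/eqP //|/eqP exx'].
have T0 : T != 0.
  by apply: contraNneq s0 => T0; rewrite -exx' T0 expr2 !mul0r !add0r.
(* Modulo 2 the difference is the sum [x + x'], which the vanishing factor expresses through the
   fixed elements [T] and [s]. *)
have ed : x - x' = - (T ^+ 2 + s) / T - 2%:R * x'.
  apply: (mulIf T0); rewrite [RHS]mulrBl divfK //.
  by apply/eqP; rewrite -subr_eq0 -[X in _ == X]exx'; apply/eqP; ring.
apply/eqP; rewrite -subr_eq0 -tr0 conj_trace_fixed // ed ch2 mul0r subr0.
by rewrite !(rmorphM, rmorphN, fmorphV, rmorphD, rmorphXn) /= pT ps.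
Qed.

Lemma twist_inj (F : fieldType) (ch2 : 2%:R = 0 :> F)
    (phi : {rmorphism F -> F}) (phi3 : forall x, phi (phi (phi x)) = x)
    (x s x' s' : F) (s0 : s != 0) (es : s ^+ 2 = conj_norm phi x)
    (s'0 : s' != 0) (es' : s' ^+ 2 = conj_norm phi x') :
  twist phi x s = twist phi x' s' -> x = x'.
Proof.
move=> ea.
have [tra Ea Na] := twist_invariants ch2 phi3 s0 es.
have [tra' Ea' Na'] := twist_invariants ch2 phi3 s'0 es'.
have eT : conj_trace phi x = conj_trace phi x' by rewrite -tra ea tra'.
rewrite -ea -eT in Ea' Na'.
case: (twist_parameter ch2 Ea Ea' Na Na') => [ess|[E4 N5]].
  by subst s'; apply: (twist_inj_same_norm ch2 phi3 s0 es).
(* Once the twist is fixed, [x] and [x'] both equal their common trace. *)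
suff pa : phi (twist phi x s) = twist phi x s.
  rewrite (twist_fixed ch2 phi3 s0 es pa) eT.
  by rewrite -(twist_fixed ch2 phi3 s'0 es') // -ea.
have := conj_root phi (twist phi x s); rewrite tra E4 N5.
have pT := phi_conj_trace phi3 x.
move: (twist _ _ _) (conj_trace _ _) pT => a T pT root_a.
(* This is the factorization of [X^3 - T X^2 + T^4 X - T^5] modulo 2. *)
have : (a - T) * (a - T ^+ 2) ^+ 2 = 0.
  rewrite -[RHS]root_a; apply/eqP; rewrite -subr_eq0; apply/eqP.
  transitivity (2%:R * (a * T ^+ 2 * (T - a))); first by ring.
  by rewrite ch2 mul0r.
move/eqP; rewrite mulf_eq0 sqrf_eq0 !subr_eq0.
by case/orP=> /eqP->; rewrite ?rmorphXn /= pT.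
Qed.

(** For [y = x^q], [z = x^(q^2)] and [x^(q^3) = x], the right side is the value of the polynomial at
    [x], term by term. *)
Lemma twist_sqr (F : fieldType) (ch2 : 2%:R = 0 :> F) (phi : {rmorphism F -> F})
    (x s : F) (x0 : x != 0) (es : s ^+ 2 = conj_norm phi x) :
  let y := phi x in let z := phi (phi x) in
  twist phi x s ^+ 2 =
  x ^+ 2 + z ^+ 3 / y * x + x ^+ 3 / z * y + z / y * x ^+ 3 + x / z * y ^+ 3.
Proof.
move=> y z; rewrite /twist expr_div_n es /conj_trace /conj_norm -/y -/z.
have y0 : y != 0 by rewrite fmorph_eq0.
have z0 : z != 0 by rewrite fmorph_eq0.
have {}es : s ^+ 2 = x * y * z by [].
move: y z y0 z0 es => y z y0 z0 es.
pose T := x + y + z; pose E := x * y + x * z + y * z.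
pose S := x ^+ 2 + y ^+ 2 + z ^+ 2.
rewrite -/T.
transitivity (x ^+ 2 * (T ^+ 2 * x ^+ 2 + T ^+ 4 + s ^+ 2
    + 2%:R * (T ^+ 3 * x + T * x * s + T ^+ 2 * s)) / (x * y * z)).
  by congr (_ / _); ring.
rewrite es ch2 mul0r addr0.
(* The added term is half the difference of the two sides, found from [T ^+ 2 = S + 2E]. *)
rewrite -[RHS]addr0 -(mul0r ((E * x ^+ 2 + 2%:R * E * S + 2%:R * E ^+ 2
  + y ^+ 2 * z ^+ 2 + S * x ^+ 2) * x / (y * z))) -ch2 /T /E /S.
by field; rewrite x0 y0 z0.
Qed.

(** Carrying [ch2] as an argument lets the morphism structures below attach to the term. *)
Definition frob2 (F : fieldType) (ch2 : 2 \in [pchar F]) (m : nat) (x : F) : F :=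
  x ^+ (2 ^ m).

Fact frob2_nmod_morphism (F : fieldType) (ch2 : 2 \in [pchar F]) m :
  nmod_morphism (@frob2 F ch2 m).
Proof.
split=> [|x y]; first by rewrite /frob2 expr0n expn_eq0.
by apply: exprDn_pchar; rewrite pnatX pnatE ?ch2.
Qed.

Fact frob2_monoid_morphism (F : fieldType) (ch2 : 2 \in [pchar F]) m :
  monoid_morphism (@frob2 F ch2 m).
Proof. by split=> [|x y]; rewrite /frob2 ?expr1n ?exprMn. Qed.

HB.instance Definition _ (F : fieldType) (ch2 : 2 \in [pchar F]) m :=
  GRing.isNmodMorphism.Build F F (@frob2 F ch2 m) (frob2_nmod_morphism ch2 m).
HB.instance Definition _ (F : fieldType) (ch2 : 2 \in [pchar F]) m :=
  GRing.isMonoidMorphism.Build F F (@frob2 F ch2 m)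
    (frob2_monoid_morphism ch2 m).

Theorem theorem3p8 (m q : nat) (m_gt0 : (0 < m)%N) (q_def : q = (2 ^ m)%N)
    (F : finFieldType) (cardF : #|F| = (q ^ 3)%N) :
  permutation_polynomial
    ('X^2 + 'X^(3 * q ^ 2 - q + 1) + 'X^(3 * q ^ 3 - q ^ 2 + q)
     + 'X^(q ^ 2 - q + 3) + 'X^(q ^ 3 - q ^ 2 + 3 * q) : {poly F}).
Proof.
have ch2 : 2 \in [pchar F].
  by apply: (@card_finPcharP _ 2 (m * 3)) => //; rewrite cardF q_def -expnM.
have two0 : 2%:R = 0 :> F by exact: pcharf0.
pose phi : {rmorphism F -> F} := @frob2 F ch2 m.
have phiE x : phi x = x ^+ q by rewrite /phi /= /frob2 -q_def.
have c3 c : c ^+ (q ^ 3) = c :> F by rewrite -cardF expf_card.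
have phi3 x : phi (phi (phi x)) = x.
  by rewrite !phiE -!exprM -[RHS]c3; congr (_ ^+ _); rewrite !expnS muln1 mulnA.
have q0 : (0 < q)%N by rewrite q_def expn_gt0.
(* These bounds ensure that no subtraction in the exponents is truncated. *)
have q_le : (q <= 3 * q ^ 2)%N by rewrite expnS expn1 mulnA leq_pmull ?muln_gt0.
have q_le2 : (q <= q ^ 2)%N by rewrite -{1}(expn1 q) leq_pexp2l.
have q2_le : (q ^ 2 <= q ^ 3)%N by rewrite leq_pexp2l.
have q2_le3 : (q ^ 2 <= 3 * q ^ 3)%N by rewrite (leq_trans q2_le) // leq_pmull.
(* Squaring is injective on a finite set, hence bijective; [rt] is the square root. *)
have [rt _ rtK] := injF_bij (sqr_inj_char2 two0 (F:=F)).
rewrite /permutation_polynomial; set f := _ + 'X^_.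
have fE (c : F) : c != 0 -> f.[c] = twist phi c (rt (conj_norm phi c)) ^+ 2.
  move=> c0; have cu : c \is a GRing.unit by rewrite unitfE.
  have pc3 n (d : nat) : c ^+ (n * d) = (c ^+ d) ^+ n by rewrite mulnC exprM.
  rewrite /f !hornerD !hornerXn !exprD !exprB // expr1 !(pc3 3) c3.
  have -> : c ^+ (q ^ 2) = phi (phi c) by rewrite !phiE -exprM.
  by rewrite -phiE (twist_sqr two0) ?rtK //; ring.
have f0 : f.[0] = 0.
  have e0 n k : (0 < k)%N -> (0 : F) ^+ (n + k) = 0.
    by move=> k0; rewrite expr0n addn_eq0 (gtn_eqF k0) andbF.
  by rewrite /f !hornerD !hornerXn !e0 ?muln_gt0 // expr0n !addr0.
have s0 (b : F) : b != 0 -> rt (conj_norm phi b) != 0.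
  by move=> b0; rewrite -sqrf_eq0 rtK !mulf_neq0 ?fmorph_eq0.
(* A zero twist is fixed, so [c] equals its trace, which is also the trace of the twist, hence 0. *)
have fN0 (c : F) : f.[c] = 0 -> c = 0.
  have [//|c0] := eqVneq c 0.
  rewrite fE // => /eqP; rewrite sqrf_eq0 => /eqP tw0.
  have [tr0 _ _] := twist_invariants two0 phi3 (s0 c c0) (rtK _).
  rewrite (twist_fixed two0 phi3 (s0 c c0) (rtK _)) ?tw0 ?rmorph0 // -tr0 tw0.
  by rewrite /conj_trace !rmorph0 !addr0.
apply: injF_bij => c d /= efcd.
have [c0|c0] := eqVneq c 0; first by rewrite c0 (fN0 d) // -efcd c0.
have [d0|d0] := eqVneq d 0; first by rewrite d0 (fN0 c) // efcd d0.
apply: (twist_inj two0 phi3 (s0 c c0) (rtK _) (s0 d d0) (rtK _)).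
by apply: (sqr_inj_char2 two0); rewrite /= -!fE.
Qed.
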